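(* Let $f(x)=\frac12x^\top Ax-b^\top x$ on $\mathbb{R}^n$, where $A$ is symmetric positive definite with $\mu I\preceq A\preceq LI$, $0<\mu\le L$, and $b\in\mathbb{R}^n$. Consider the SR1 iteration: given $x_0$ and an initial Hessian approximation $G_0$ with $A\preceq G_0$, for $k=0,1,\dots$ set $x_{k+1}=x_k-G_k^{-1}\nabla f(x_k)$, $u_k=x_{k+1}-x_k$, $G_{k+1}=\mathrm{SR1}(A,G_k,u_k)$. If $u_i^\top(G_i-A)u_i>0$ for $i=0,\dots,k$, then for all $k\ge 0$, $$\lambda_f(x_k)\le\prod_{j=1}^{k}\left(1-\frac{\lambda_{\min}(G_{j-1}-A)}{\sum_{i=1}^{n-j+1}\lambda_i(G_{j-1}-A)}\right)\cdot\frac{\mathrm{tr}(G_0-A)}{\mu}\cdot\lambda_f(x_0)\le\prod_{j=1}^{k}\left(1-\frac{1}{(n-j+1)\cdot\kappa(G_0-A)}\right)\frac{\mathrm{tr}(G_0-A)}{\mu}\cdot\lambda_f(x_0).$$ Moreover, letting $k>1$ be the first index such that $u_k^\top(G_k-A)u_k=0$, the point $x_{k+1}$ is the minimizer of $f$.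
   Context: $\lambda_f(x)=\sqrt{\nabla f(x)^\top A^{-1}\nabla f(x)}$. For a positive semidefinite matrix $B$, $\lambda_1(B)\ge\lambda_2(B)\ge\cdots$ denote its eigenvalues, $\lambda_{\min}(B)$ denotes its smallest nonzero eigenvalue, and $\kappa(B)=\lambda_{\max}(B)/\lambda_{\min}(B)$. For symmetric matrices $A,G$ and $u\neq0$, $\mathrm{SR1}(A,G,u)=G$ if $(G-A)u=0$, and otherwise $\mathrm{SR1}(A,G,u)=G-\frac{(G-A)uu^\top(G-A)}{u^\top(G-A)u}$.
   Formalization: The bounds are stated for k ≥ 1 instead of k ≥ 0: at k = 0 the first reads λ_f(x_0) ≤ (tr(G_0−A)/μ) λ_f(x_0), which fails for n=1, A=μ=L=1, b=0, G_0=3/2, x_0=1. *)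

(* Defs.v *)
From HB Require Import structures.
From mathcomp Require Import all_boot all_order all_algebra.
From mathcomp Require Import reals.
From Stdlib Require Import ClassicalEpsilon.
Set Implicit Arguments. Unset Strict Implicit. Unset Printing Implicit Defensive.
Import Order.TTheory GRing.Theory Num.Theory.
Local Open Scope ring_scope.

Section Defs.
Variables (R : realType) (n : nat).

Definition quad (M : 'M[R]_n) (u : 'cV[R]_n) : R := (u^T *m M *m u) ord0 ord0.

Definition psd (M : 'M[R]_n) : Prop := forall v : 'cV[R]_n, 0 <= quad M v.

Definition fq (A : 'M[R]_n) (b x : 'cV[R]_n) : R :=
  2^-1 * quad A x - (b^T *m x) ord0 ord0.
Definition grad (A : 'M[R]_n) (b x : 'cV[R]_n) : 'cV[R]_n := A *m x - b.

Definition lamf (A : 'M[R]_n) (b x : 'cV[R]_n) : R :=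
  Num.sqrt (quad (invmx A) (grad A b x)).

(* eigenvalues with multiplicity, in nonincreasing order: the (unique, when it
   exists) nonincreasing sequence s of length n whose roots split the
   characteristic polynomial *)
Definition is_eigseq (B : 'M[R]_n) (s : seq R) : Prop :=
  size s = n /\ sorted (fun a c => c <= a) s /\
  char_poly B = \prod_(a <- s) ('X - a%:P).
Definition eigs (B : 'M[R]_n) : seq R :=
  epsilon (inhabits [::]) (is_eigseq B).

(* lambda_i(B), 1-indexed: lambda_1 >= lambda_2 >= ... *)
Definition lam (B : 'M[R]_n) (i : nat) : R := nth 0 (eigs B) i.-1.
Definition lmax (B : 'M[R]_n) : R := lam B 1.
Definition lmin (B : 'M[R]_n) : R := last 0 [seq a <- eigs B | a != 0].
Definition kappa (B : 'M[R]_n) : R := lmax B / lmin B.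

Definition SR1 (A G : 'M[R]_n) (u : 'cV[R]_n) : 'M[R]_n :=
  if (G - A) *m u == 0 then G
  else G - (quad (G - A) u)^-1 *: ((G - A) *m u *m u^T *m (G - A)).

End Defs.

(* Main.v *)
(* Write [D_k = G_k - A]. As long as the curvature [u_k^T D_k u_k] is positive,
   the SR1 update subtracts from [D_k] the rank-one matrix
   [D_k u_k u_k^T D_k / (u_k^T D_k u_k)]. It keeps [D_k] positive semidefinite,
   lowers its rank (so that the eigenvalues of index beyond [n - k] vanish), does
   not increase the largest eigenvalue, does not decrease the smallest nonzero
   one, and lowers the trace by
   [|D_k u_k|^2 / (u_k^T D_k u_k) >= lambda_min(D_k)]. Iterating the last point
   bounds [tr D_k] by the product times [tr D_0]. On the other hand
   [grad f(x_{k+1}) = - D_k u_k] gives both [lambda_f(x_{k+1}) <= lambda_f(x_k)]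
   and [lambda_f(x_{k+1}) <= lambda_1(D_k) / mu * lambda_f(x_k)]. The latter is
   only used for the last step, and the last factor of the product is available
   because [lambda_1(D_{k-1}) <= tr D_{k-1} - lambda_min(D_{k-1})]: this fails
   only if [D_{k-1}] has rank one, but then [D_k = 0]. *)
Require Import Defs.
From HB Require Import structures.
From mathcomp Require Import all_boot all_order all_algebra.
From mathcomp Require Import reals.
From mathcomp Require Import complex ring lra.
From Stdlib Require ClassicalEpsilon.
Import Order.TTheory GRing.Theory Num.Theory.
Local Open Scope ring_scope.

Set Implicit Arguments.
Unset Strict Implicit.

(** * Spectral decomposition of real symmetric matrices, through [R[i]] *)

Section Spectral.
Variables (R : realType) (n : nat).
Implicit Types (B : 'M[R]_n) (v : 'cV[R]_n) (d : 'rV[R]_n).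
Local Notation toC := (map_mx (@real_complex_def R (Phant R))).
Local Open Scope sesquilinear_scope.

(** The principal submatrix on the nonzero diagonal entries is diagonal and invertible, and a
    submatrix cannot exceed the rank. *)
Lemma rank_diag_mx_ge (F : fieldType) m (d : 'rV[F]_m) :
  (#|[pred i | d ord0 i != 0%R]| <= \rank (diag_mx d))%N.
Proof.
set S := [pred i | _].
pose E : 'M[F]_(#|S|, m) := rowsub enum_val 1%:M.
pose e : 'rV[F]_#|S| := \row_i d ord0 (enum_val i).
have eE : E *m diag_mx d *m E^T = diag_mx e.
  apply/matrixP => i j; rewrite !mxE (bigD1 (enum_val j)) //=.
    rewrite big1 => [|l /negPf lj]; last by rewrite !mxE eq_sym lj mulr0.
    rewrite mul_mx_diag !mxE eqxx mulr1 addr0 (inj_eq enum_val_inj).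
    by case: eqP => [->|_]; rewrite ?mul1r ?mul0r.
have : diag_mx e \in unitmx.
  rewrite unitmxE det_diag unitfE; apply/prodf_neq0 => i _.
  by rewrite mxE; have := enum_valP i.
move=> /mxrank_unit <-; rewrite -eE.
exact: leq_trans (mxrankM_maxl _ _) (mxrankM_maxr _ _).
Qed.

Lemma unitary_conj_sqr (C : numClosedFieldType) m (P D : 'M[C]_m) :
  P \is unitarymx ->
  P^t* *m D *m P *m (P^t* *m D *m P) = P^t* *m (D *m D) *m P.
Proof. by move=> Pu; rewrite !mulmxA mulmxtVK. Qed.

(** Over [R[i]] the matrix is Hermitian, hence unitarily diagonalizable with real eigenvalues. So
    [d] lives over [R], while [P] stays complex. *)
Lemma real_spectral B : B^T = B ->
  exists (P : 'M[R[i]]_n) d,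
    P \is unitarymx /\ toC B = P^t* *m diag_mx (toC d) *m P.
Proof.
move=> Bs.
have BH : toC B \is hermsymmx.
  apply: realsym_hermsym.
    apply/is_hermitianmxP; rewrite expr0 scale1r; apply/matrixP => i j.
    by rewrite !mxE -[in LHS]Bs mxE.
  by apply/mxOverP => i j; rewrite mxE; apply/complex_realP; exists (B i j).
have /hermitian_normalmx /orthomx_spectralP eB := BH.
exists (spectralmx (toC B)), (map_mx (@complex.Re R) (spectral_diag (toC B))).
split; first exact: spectral_unitarymx.
have -> : toC (map_mx (@complex.Re R) (spectral_diag (toC B))) =
    spectral_diag (toC B).
  apply/rowP => i; rewrite 2!mxE; apply: RRe_real.
  exact: (mxOverP (hermitian_spectral_diag_real BH)).
by rewrite -(invmx_unitary (spectral_unitarymx _)); exact: eB.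
Qed.

(* The weights are the squared moduli of the coordinates of [P v]: they do not
   depend on [M], so one choice serves [1], [B] and [B^2] simultaneously. *)
Lemma spectral_quad (P : 'M[R[i]]_n) v : exists w : 'I_n -> R,
  (forall i, 0 <= w i) /\
  forall (M : 'M[R]_n) d, toC M = P^t* *m diag_mx (toC d) *m P ->
    quad M v = \sum_i d ord0 i * w i.
Proof.
pose z := P *m toC v.
have [w w0 wE] : exists2 w : 'I_n -> R, (forall i, 0 <= w i) &
    forall i, real_complex R (w i) = (z i ord0)^* * z i ord0.
  have zr i : real_complex R (complex.Re (`|z i ord0| ^+ 2)) = `|z i ord0| ^+ 2.
    by rewrite RRe_real // ger0_real // exprn_ge0.
  exists (fun i => complex.Re (`|z i ord0| ^+ 2)) => i.
    by rewrite -lecR zr exprn_ge0.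
  by rewrite zr normCK mulrC.
exists w; split=> // M d eM.
apply: (@complexI R); rewrite rmorph_sum.
transitivity ((toC (v^T *m M *m v)) ord0 ord0); first by rewrite mxE.
rewrite !map_mxM eM /=.
(* Conjugation fixes [toC v], since [v] is real. *)
have zt : z^t* = toC v^T *m P^t*.
  rewrite /z trmx_mul map_mxM; congr (_ *m _); apply/matrixP => i j.
  by rewrite !mxE; apply/CrealP/complex_realP; exists (v j i).
rewrite !mulmxA -zt -(mulmxA _ P) -/z.
rewrite -mulmxA mxE; apply: eq_bigr => i _.
transitivity (real_complex R (d ord0 i) * real_complex R (w i)).
  by rewrite wE mul_diag_mx !mxE mulrCA.
by rewrite -rmorphM.
Qed.

Lemma sym_char_poly B P d : P \is unitarymx ->
  toC B = P^t* *m diag_mx (toC d) *m P ->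
  char_poly B = \prod_(a <- codom (d ord0)) ('X - a%:P).
Proof.
move=> Pu eB; apply: (map_poly_inj (real_complex R)).
rewrite map_char_poly eB rmorph_prod.
have PP : map_mx polyC (P^t*) *m map_mx polyC P = 1%:M.
  rewrite -map_mxM -invmx_unitary // mulVmx ?map_mx1 //.
  exact: unitarymx_unit.
rewrite /char_poly.
have -> : char_poly_mx (P^t* *m diag_mx (toC d) *m P) =
    map_mx polyC (P^t*) *m char_poly_mx (diag_mx (toC d)) *m map_mx polyC P.
  rewrite /char_poly_mx mulmxBr mulmxBl -!map_mxM; congr (_ - _).
  by rewrite mul_mx_scalar -scalemxAl PP scalemx1.
rewrite !det_mulmx mulrAC -det_mulmx PP det1 mul1r.
rewrite -[LHS]/(char_poly _) char_poly_trig ?diag_mx_is_trig // big_image /=.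
apply: eq_bigr => i _.
by rewrite rmorphB /= map_polyX map_polyC !mxE eqxx mulr1n.
Qed.

(** Sorting the diagonal of the spectral decomposition gives a witness, so the epsilon in [eigs]
    meets its specification on symmetric matrices. *)
Lemma eigsP B : B^T = B -> is_eigseq B (eigs B).
Proof.
move=> Bs; have [P [d [Pu eB]]] := real_spectral Bs.
apply: ClassicalEpsilon.epsilon_spec; exists (sort >=%O (codom (d ord0))).
split; last split.
- by rewrite size_sort size_codom card_ord.
- exact/sort_sorted/ge_total.
- rewrite (sym_char_poly Pu eB); apply: perm_big.
  by rewrite perm_sym; apply/permPl/perm_sort.
Qed.

(** Both lists split the characteristic polynomial into linear factors, and such a factorization is
    unique up to order. *)
Lemma perm_eigs B P d : P \is unitarymx ->
  toC B = P^t* *m diag_mx (toC d) *m P -> B^T = B ->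
  perm_eq (eigs B) (codom (d ord0)).
Proof.
move=> Pu eB Bs; have [_ [_ eC]] := eigsP Bs.
by apply: prod_XsubC_eq; rewrite -(sym_char_poly Pu eB).
Qed.

Lemma sum_eigs B : B^T = B -> \sum_(a <- eigs B) a = \tr B.
Proof.
move=> Bs; have [P [d [Pu eB]]] := real_spectral Bs.
rewrite (perm_big _ (perm_eigs Pu eB Bs)) big_image /=.
apply: (@complexI R); transitivity (\tr (toC B)); last by rewrite trace_map_mx.
rewrite eB mxtrace_mulC mulmxA (unitarymxP Pu) mul1mx mxtrace_diag rmorph_sum.
by apply: eq_bigr => i _; rewrite mxE.
Qed.

Lemma count_eigs_rank B : B^T = B -> (count (predC1 0%R) (eigs B) <= \rank B)%N.
Proof.
move=> Bs; have [P [d [Pu eB]]] := real_spectral Bs.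
rewrite (permP (perm_eigs Pu eB Bs)) count_map.
rewrite -(mxrank_map (real_complex R)) eB.
have Pi := unitarymx_unit Pu.
rewrite mxrankMfree ?row_free_unit // -mxrank_tr trmx_mul mxrankMfree; last first.
  by rewrite row_free_unit unitmx_tr -invmx_unitary // unitmx_inv.
rewrite mxrank_tr -map_diag_mx mxrank_map; apply: leq_trans (rank_diag_mx_ge _).
by rewrite cardE size_filter -enumT.
Qed.

(* A quadratic polynomial that is nonnegative on the spectrum of [B] gives a
   positive semidefinite matrix at [B]. *)
Lemma quad_eigs_ge0 B (c0 c1 c2 : R) v : B^T = B ->
  (forall a, a \in eigs B -> 0 <= c0 + c1 * a + c2 * a ^+ 2) ->
  0 <= c0 * quad 1%:M v + c1 * quad B v + c2 * quad (B *m B) v.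
Proof.
move=> Bs c_ge0; have [P [d [Pu eB]]] := real_spectral Bs.
have [w [w0 wE]] := spectral_quad P v.
have PP : P^t* *m P = 1%:M.
  by rewrite -invmx_unitary // mulVmx // unitarymx_unit.
have e1 : toC 1%:M = P^t* *m diag_mx (toC (const_mx 1)) *m P.
  by rewrite map_const_mx rmorph1 diag_const_mx mulmx1 PP.
have e2 : toC (B *m B) = P^t* *m diag_mx (toC (\row_i d ord0 i ^+ 2)) *m P.
  have -> : diag_mx (toC (\row_i d ord0 i ^+ 2)) =
      diag_mx (toC d) *m diag_mx (toC d).
    rewrite mulmx_diag; congr diag_mx; apply/rowP => i.
    by rewrite !mxE -rmorphM.
  rewrite -(unitary_conj_sqr _ Pu) -eB.
  exact: map_mxM.
rewrite (wE _ _ e1) (wE _ _ eB) (wE _ _ e2) !mulr_sumr -!big_split /=.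
apply: sumr_ge0 => i _; rewrite !mxE mul1r !mulrA -!mulrDl.
apply: mulr_ge0 => //; rewrite -mulrA -expr2; apply: c_ge0.
rewrite (perm_mem (perm_eigs Pu eB Bs)).
exact: codom_f.
Qed.

Lemma eigs_eigenvector B a : B^T = B -> a \in eigs B ->
  exists2 v : 'cV[R]_n, v != 0 & B *m v = a *: v.
Proof.
move=> Bs ai; have [_ [_ eC]] := eigsP Bs.
have : eigenvalue B a by rewrite eigenvalue_root_char eC root_prod_XsubC.
case/eigenvalueP => v vB v0; exists v^T.
  by rewrite trmx_eq0.
by rewrite -[B]Bs -trmx_mul vB linearZ.
Qed.

End Spectral.

(** * Inner product and kernels of semidefinite forms *)

Section Dot.
Variables (R : realType) (n : nat).
Implicit Types (B D : 'M[R]_n) (u v : 'cV[R]_n).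

Definition dot u v : R := (u^T *m v) ord0 ord0.

Lemma quadE B v : quad B v = dot v (B *m v).
Proof. by rewrite /quad /dot mulmxA. Qed.

Lemma dotC u v : dot u v = dot v u.
Proof. by rewrite /dot -[in RHS](trmxK u) -trmx_mul [RHS]mxE. Qed.

Lemma dotDr u v w : dot u (v + w) = dot u v + dot u w.
Proof. by rewrite /dot mulmxDr mxE. Qed.

Lemma dotZr a u v : dot u (a *: v) = a * dot u v.
Proof. by rewrite /dot -scalemxAr mxE. Qed.

Lemma dotNr u v : dot u (- v) = - dot u v.
Proof. by rewrite -scaleN1r dotZr mulN1r. Qed.

Lemma dotDl u v w : dot (v + w) u = dot v u + dot w u.
Proof. by rewrite ![dot _ u]dotC dotDr. Qed.

Lemma dotZl a u v : dot (a *: v) u = a * dot v u.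
Proof. by rewrite ![dot _ u]dotC dotZr. Qed.

Lemma dotNl u v : dot (- v) u = - dot v u.
Proof. by rewrite ![dot _ u]dotC dotNr. Qed.

Definition dotE := (dotDr, dotDl, dotNr, dotNl, dotZr, dotZl).

Lemma dot_adj B u v : B^T = B -> dot u (B *m v) = dot (B *m u) v.
Proof. by move=> Bs; rewrite /dot trmx_mul Bs mulmxA. Qed.

Lemma dot_sum_sqr v : dot v v = \sum_i v i ord0 ^+ 2.
Proof. by rewrite /dot mxE; apply: eq_bigr => i _; rewrite mxE. Qed.

Lemma dot_ge0 v : 0 <= dot v v.
Proof. by rewrite dot_sum_sqr sumr_ge0 // => i _; rewrite sqr_ge0. Qed.

Lemma dot_gt0 v : v != 0 -> 0 < dot v v.
Proof.
move=> v0; rewrite lt_neqAle dot_ge0 eq_sym andbT; apply: contra v0.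
rewrite dot_sum_sqr psumr_eq0 => [|i _]; last exact: sqr_ge0.
move=> /allP v0; apply/eqP/colP => i; rewrite mxE; apply/eqP.
by rewrite -sqrf_eq0; apply: v0; rewrite mem_index_enum.
Qed.

(** If [B v] were nonzero, moving from [v] a little along [- B v] would make the form negative. *)
Lemma psd_ker B v : B^T = B -> psd B -> quad B v = 0 -> B *m v = 0.
Proof.
move=> Bs Bp q0; apply/eqP/negPn/negP => /dot_gt0 Bv0.
set a := dot (B *m v) (B *m v) in Bv0; set q := quad B (B *m v).
have q_ge0 : 0 <= q by exact: Bp.
have key t : 0 <= t ^+ 2 * q - 2 * t * a.
  have := Bp (v - t *: (B *m v)); rewrite quadE mulmxDr mulmxN -scalemxAr !dotE.
  rewrite -!quadE q0 -/q (dot_adj v (B *m v) Bs) -/a => h; apply: le_trans h _.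
  by rewrite le_eqVlt; apply/orP; left; apply/eqP; ring.
have q1 : 0 < q + 1 by lra.
(* With this [t] the right side of [key] is [- t ^+ 2 * (q + 2)], which is negative; the [+ 1] keeps
   the denominator positive when [q = 0]. *)
have := key (a / (q + 1)); set t := a / (q + 1).
have ea : a = t * (q + 1) by rewrite /t divfK ?gt_eqF.
have t0 : 0 < t by exact: divr_gt0.
rewrite ea; nra.
Qed.

End Dot.

(** * Extreme eigenvalues, partial sums of eigenvalues and the trace *)

Section EigenBounds.
Variables (R : realType) (n : nat).
Implicit Types (B : 'M[R]_n) (v : 'cV[R]_n).

Lemma quad1E v : quad (1%:M : 'M[R]_n) v = dot v v.
Proof. by rewrite quadE mul1mx. Qed.

Lemma quad_sqrE B v : B^T = B -> quad (B *m B) v = dot (B *m v) (B *m v).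
Proof. by move=> Bs; rewrite quadE -mulmxA dot_adj. Qed.

Lemma eigs_ge0 B a : B^T = B -> psd B -> a \in eigs B -> 0 <= a.
Proof.
move=> Bs Bp /(eigs_eigenvector Bs)[v /dot_gt0 v0 Bv].
by have := Bp v; rewrite quadE Bv dotZr pmulr_lge0.
Qed.

Lemma eigs_le_lmax B a : B^T = B -> a \in eigs B -> a <= lmax B.
Proof.
move=> Bs; have [_ [+ _]] := eigsP Bs; rewrite /lmax /lam /=.
case: (eigs B) => //= b s bs; rewrite inE => /predU1P[->//|].
by move: bs; rewrite (path_sortedE (rev_trans le_trans)) => /andP[/allP h _] /h.
Qed.

Lemma lmin_le B a : B^T = B -> a \in eigs B -> a != 0 -> lmin B <= a.
Proof.
move=> Bs aB a0; have [_ [+ _]] := eigsP Bs; rewrite /lmin.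
move=> /(sorted_filter (rev_trans le_trans) (fun a => a != 0)).
have : a \in [seq a <- eigs B | a != 0] by rewrite mem_filter a0.
elim/last_ind: [seq _ <- _ | _] => // s b _; rewrite last_rcons mem_rcons inE.
move=> /predU1P[->//|sa]; rewrite (sorted_pairwise (rev_trans le_trans)).
by rewrite pairwise_rcons => /andP[/allP/(_ _ sa)].
Qed.

Lemma lmin_mem B a : a \in eigs B -> a != 0 -> lmin B \in eigs B /\ lmin B != 0.
Proof.
move=> aB a0; rewrite /lmin.
have : a \in [seq a <- eigs B | a != 0] by rewrite mem_filter a0.
case es : [seq _ <- _ | _] => [|b s] // _.
have := mem_last b s; rewrite -es mem_filter -[last b s]/(last 0 (b :: s)) -es.
by move=> /andP[? ?]; split.
Qed.

(** The polynomial [a ^+ 2 - lmin B * a] is nonnegative on the spectrum: it vanishes at 0, and every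
    other eigenvalue is at least [lmin B]. *)
Lemma lmin_quad B v : B^T = B -> psd B ->
  lmin B * dot v (B *m v) <= dot (B *m v) (B *m v).
Proof.
move=> Bs Bp; have := @quad_eigs_ge0 _ _ B 0 (- lmin B) 1 v Bs.
rewrite quad1E quad_sqrE // quadE => h; suff: 0 <= 0 * dot v v +
  - lmin B * dot v (B *m v) + 1 * dot (B *m v) (B *m v) by lra.
apply: h => a aB; have := eigs_ge0 Bs Bp aB.
have [->|a0] := eqVneq a 0; first by nra.
by have := lmin_le Bs aB a0; nra.
Qed.

Lemma quad_le_lmax B v : B^T = B -> dot v (B *m v) <= lmax B * dot v v.
Proof.
move=> Bs; have := @quad_eigs_ge0 _ _ B (lmax B) (- 1) 0 v Bs.
rewrite quad1E quadE => h; suff: 0 <= lmax B * dot v v +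
  -1 * dot v (B *m v) + 0 * quad (B *m B) v by lra.
by apply: h => a /(eigs_le_lmax Bs); lra.
Qed.

Lemma sqr_le_lmax B v : B^T = B -> psd B ->
  dot (B *m v) (B *m v) <= lmax B ^+ 2 * dot v v.
Proof.
move=> Bs Bp; have := @quad_eigs_ge0 _ _ B (lmax B ^+ 2) 0 (- 1) v Bs.
rewrite quad1E quad_sqrE // => h; suff: 0 <= lmax B ^+ 2 * dot v v +
  0 * quad B v + -1 * dot (B *m v) (B *m v) by lra.
by apply: h => a aB; have := eigs_le_lmax Bs aB; have := eigs_ge0 Bs Bp aB; nra.
Qed.

(** Otherwise [- a] would be nonnegative on the spectrum, forcing [quad B v <= 0]. This is what
    makes [lmin B] a true eigenvalue and not the default 0. *)
Lemma eigs_neq0 B v : B^T = B -> 0 < quad B v ->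
  exists2 a, a \in eigs B & a != 0.
Proof.
move=> Bs Bv; apply/hasP; rewrite -[has _ _]negbK; apply/negP => /hasPn e0.
have h := @quad_eigs_ge0 _ _ B 0 (- 1) 0 v Bs.
suff: 0 <= 0 * quad 1%:M v + -1 * quad B v + 0 * quad (B *m B) v by lra.
by apply: h => a /e0; rewrite negbK => /eqP->; lra.
Qed.

(** Test the inequality on an eigenvector for [lmin B]. As a converse to [lmin_quad], it lets a
    lower bound on the nonzero spectrum travel through the updates as an inequality on vectors,
    without interlacing. *)
Lemma lmin_ge B v (m : R) : B^T = B -> psd B -> 0 < quad B v ->
  (forall v, m * dot v (B *m v) <= dot (B *m v) (B *m v)) -> m <= lmin B.
Proof.
move=> Bs Bp /(eigs_neq0 Bs)[a aB a0] h.
have [lB l0] := lmin_mem aB a0.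
have lp : 0 < lmin B by rewrite lt_neqAle eq_sym l0 (eigs_ge0 Bs Bp lB).
have [w /dot_gt0 w0 Bw] := eigs_eigenvector Bs lB.
have := h w; rewrite Bw !dotE => k.
by rewrite -(ler_pM2r (mulr_gt0 lp w0)).
Qed.

Lemma lmax_le B v (M : R) : B^T = B -> 0 < quad B v ->
  (forall v, dot v (B *m v) <= M * dot v v) -> lmax B <= M.
Proof.
move=> Bs /(eigs_neq0 Bs)[a aB _] h.
have lB : lmax B \in eigs B.
  by move: aB; rewrite /lmax /lam; case: (eigs B) => //= b s _; rewrite mem_head.
have [w /dot_gt0 w0 Bw] := eigs_eigenvector Bs lB.
by have := h w; rewrite Bw !dotE ler_pM2r.
Qed.

(** In a nonincreasing nonnegative sequence the zeros come last, so the first [m] terms include all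
    nonzero ones; past the end, [nth] returns 0. *)
Lemma sum_nth_sorted (s : seq R) m :
  sorted >=%O s -> {in s, forall a, 0 <= a} ->
  (count (predC1 0%R) s <= m)%N -> \sum_(0 <= i < m) s`_i = \sum_(a <- s) a.
Proof.
elim: s m => [|x s IHs] m ss s0 cs.
  by rewrite big_nil big1 // => i _; rewrite nth_nil.
have cs' : (count (predC1 0%R) s <= m.-1)%N.
  move: cs => /=; have [x0 _|x0] := eqVneq x 0; last by case: (m).
  suff /eqP -> : count (predC1 0%R) s == 0%N by [].
  rewrite -leqn0 leqNgt -has_count; apply/hasPn => a sa /=; rewrite negbK.
  move: ss; rewrite /= (path_sortedE (rev_trans le_trans)) x0.
  move=> /andP[/allP/(_ _ sa) h _].
  by rewrite eq_le h s0 // inE sa orbT.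
have s'0 : {in s, forall a, 0 <= a} by move=> a sa; rewrite s0 // inE sa orbT.
case: m cs cs' => [|m] cs cs'.
  rewrite big_geq // big_seq big1 // => a xa; apply/eqP; move: cs.
  rewrite leqn0 -[_ == _]negbK -lt0n -has_count => /hasPn/(_ _ xa)/=.
  by rewrite negbK.
by rewrite big_nat_recl //= big_cons IHs // (path_sorted ss).
Qed.

Lemma sum_lam B m : B^T = B -> psd B -> (\rank B <= m)%N ->
  \sum_(1 <= i < m.+1) lam B i = \tr B.
Proof.
move=> Bs Bp rB; rewrite -sum_eigs // big_add1 /=; have [_ [ss _]] := eigsP Bs.
apply: (sum_nth_sorted ss) => [a|]; first exact: eigs_ge0.
exact: leq_trans (count_eigs_rank Bs) rB.
Qed.

(** With two nonzero eigenvalues, the first and the last nonzero one occupy different places in the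
    list and both count in the trace; with at most one, that one (or 0) is the whole trace. *)
Lemma lmax_lmin_trace B : B^T = B -> psd B ->
  lmax B + lmin B <= \tr B \/ \tr B = lmin B.
Proof.
move=> Bs Bp; rewrite -sum_eigs // /lmax /lmin /lam /=.
have : {in eigs B, forall a, 0 <= a} by move=> a; exact: eigs_ge0.
case: (eigs B) => [|x s] s0 /=; first by right; rewrite big_nil.
have s'0 a : a \in s -> 0 <= a by move=> sa; rewrite s0 // inE sa orbT.
rewrite big_cons.
have [/hasP[a sa a0]|/hasPn h] := boolP (has (fun a => a != 0) s).
  left; rewrite lerD2l.
  have : a \in [seq a <- s | a != 0] by rewrite mem_filter a0.
  case es : [seq _ <- s | _] => [|b t] // _.
  have -> : last 0 (if x != 0 then x :: b :: t else b :: t) = last b t.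
    by case: ifP.
  have : last b t \in s.
    by have := mem_last b t; rewrite -es mem_filter => /andP[].
  move=> ls; rewrite (big_rem _ ls) /= lerDl big_seq sumr_ge0 // => c /mem_rem.
  exact: s'0.
right; have -> : [seq a <- s | a != 0] = [::].
  by apply/eqP; rewrite -size_eq0 size_filter eqn0Ngt -has_count; apply/hasPn.
rewrite big_seq big1 ?addr0; first by case: eqVneq => //= ->.
by move=> a /h; rewrite negbK => /eqP.
Qed.

Lemma trace_gt0 B v : B^T = B -> psd B -> 0 < quad B v -> 0 < \tr B.
Proof.
move=> Bs Bp /(eigs_neq0 Bs)[a aB a0]; rewrite -sum_eigs // (big_rem _ aB) /=.
apply: ltr_wpDr.
  by rewrite big_seq sumr_ge0 // => c /mem_rem/(eigs_ge0 Bs Bp).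
by rewrite lt_neqAle eq_sym a0 (eigs_ge0 Bs Bp aB).
Qed.

End EigenBounds.

(** * The rank-one downdate of the error matrix *)

Section Downdate.
Variables (R : realType) (n : nat).
Implicit Types (A G D : 'M[R]_n) (u v : 'cV[R]_n).

(** Wedderburn's rank-one reduction of [D] along [u]. *)
Definition downdate D u : 'M[R]_n :=
  D - (quad D u)^-1 *: (D *m u *m u^T *m D).

Lemma SR1_sub A G u : 0 < quad (G - A) u -> SR1 A G u - A = downdate (G - A) u.
Proof.
move=> q0; rewrite /SR1 ifN; first by rewrite addrAC.
by apply: contraTneq q0 => Du; rewrite quadE Du /dot mulmx0 mxE ltxx.
Qed.

Lemma outerE u v w : u *m v^T *m w = dot v w *: u.
Proof.
by rewrite -mulmxA [v^T *m w]mx11_scalar mul_mx_scalar.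
Qed.

(** When [quad D u] is nonzero, the vector on the right is the part of [v] that is [D]-orthogonal to
    [u]: the downdate is [D] after this projection. *)
Lemma downdate_mul D u v : D^T = D ->
  downdate D u *m v = D *m (v - (dot u (D *m v) / quad D u) *: u).
Proof.
move=> Ds; rewrite mulmxBl mulmxBr -scalemxAl -(mulmxA _ D) outerE.
by rewrite -scalemxAr scalerA mulrC.
Qed.

Lemma downdate_sym D u : D^T = D -> (downdate D u)^T = downdate D u.
Proof.
move=> Ds; rewrite /downdate linearB /= linearZ /=.
by rewrite !trmx_mul trmxK Ds !mulmxA.
Qed.

Lemma downdate_quad D u v : D^T = D -> 0 < quad D u ->
  quad (downdate D u) v = quad D (v - (dot u (D *m v) / quad D u) *: u).
Proof.
move=> Ds q0; rewrite quadE downdate_mul //; set w := v - _ *: u.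
have -> : dot v (D *m w) =
    dot w (D *m w) + dot u (D *m v) / quad D u * dot u (D *m w).
  by rewrite /w !dotE; ring.
suff -> : dot u (D *m w) = 0 by rewrite mulr0 addr0 quadE.
rewrite mulmxBr -scalemxAr !dotE -quadE divfK ?subrr //.
by rewrite gt_eqF.
Qed.

Lemma downdate_psd D u : D^T = D -> psd D -> 0 < quad D u -> psd (downdate D u).
Proof. by move=> Ds Dp q0 v; rewrite downdate_quad. Qed.

Lemma downdate_quad_le D u v : D^T = D -> 0 < quad D u ->
  quad (downdate D u) v <= quad D v.
Proof.
move=> Ds q0; rewrite quadE downdate_mul // mulmxBr -scalemxAr !dotE -quadE.
rewrite lerBlDr lerDl (dot_adj v u Ds) dotC mulrAC -expr2.
by rewrite mulr_ge0 ?sqr_ge0 // invr_ge0 ltW.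
Qed.

(* The hypothesis says that the nonzero eigenvalues of [D] are at least [m]; it
   passes to the downdate since [downdate D u *m v = D *m w] and
   [quad (downdate D u) v = quad D w] for the same [w]. *)
Lemma downdate_lower D u (m : R) : D^T = D -> 0 < quad D u ->
  (forall v, m * dot v (D *m v) <= dot (D *m v) (D *m v)) ->
  forall v, m * dot v (downdate D u *m v)
              <= dot (downdate D u *m v) (downdate D u *m v).
Proof.
by move=> Ds q0 h v; rewrite -quadE downdate_quad // downdate_mul // quadE.
Qed.

Lemma downdate_trace D u : D^T = D -> psd D -> 0 < quad D u ->
  \tr (downdate D u) <= \tr D - lmin D.
Proof.
move=> Ds Dp q0; rewrite linearB /= linearZ /= lerD2l lerN2.
rewrite -[X in D *m u *m u^T *m X]Ds -mulmxA -trmx_mul mxtrace_mulC.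
rewrite [\tr _]big_ord1 -[X in _ <= _ * X]/(dot (D *m u) (D *m u)).
by rewrite mulrC ler_pdivlMr // quadE lmin_quad.
Qed.

(** The kernel grows strictly: it keeps the kernel of [D] and gains [u], which positive curvature
    keeps out of the kernel of [D]. *)
Lemma downdate_rank D u : D^T = D -> 0 < quad D u ->
  (\rank (downdate D u) < \rank D)%N.
Proof.
move=> Ds q0; have Dds := downdate_sym u Ds.
have lt_ker : (kermx D < kermx (downdate D u))%MS.
  apply/andP; split.
    apply/sub_kermxP; have /sub_kermxP kD := submx_refl (kermx D).
    by rewrite mulmxBr -scalemxAr !mulmxA kD !mul0mx scaler0 subr0.
  apply/negP => le_ker; have : (u^T <= kermx D)%MS.
    apply: submx_trans le_ker; apply/sub_kermxP.
    rewrite -Dds -trmx_mul downdate_mul // -quadE divff ?gt_eqF //.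
    by rewrite scale1r subrr mulmx0 trmx0.
  by move/sub_kermxP => uD; move: q0; rewrite /quad uD mul0mx mxE ltxx.
have := rank_ltmx lt_ker; rewrite !mxrank_ker => h.
by rewrite ltnNge; apply/negP => /(leq_sub2l n); rewrite leqNgt h.
Qed.

End Downdate.

(** * Invertibility of the Hessian approximations *)

Section Coercive.
Variables (R : realType) (n : nat) (A D : 'M[R]_n) (mu : R).
Implicit Types u v : 'cV[R]_n.
Hypotheses (As : A^T = A) (Ds : D^T = D) (Dp : psd D).
Hypotheses (mu_gt0 : 0 < mu) (A_mu : psd (A - mu%:M)).

Lemma hess_quad_ge v : mu * dot v v <= dot v (A *m v).
Proof.
have := A_mu v; rewrite quadE mulmxBl mul_scalar_mx !dotE; lra.
Qed.

(** The form of [A + D] dominates [mu * dot v v], so no nonzero vector is in the kernel. Applied to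
    [G k = A + D k], this makes the [invmx] of the iteration a true inverse. *)
Lemma coercive_unitmx : A + D \in unitmx.
Proof.
rewrite -unitmx_tr -row_free_unit -kermx_eq0; apply/rowV0P => v /sub_kermxP vAD.
apply/eqP; rewrite -trmx_eq0; apply/negPn/negP => /dot_gt0 v0.
have : dot v^T ((A + D) *m v^T) = 0.
  by rewrite -[A + D]trmxK -trmx_mul vAD trmx0 /dot mulmx0 mxE.
rewrite mulmxDl dotDr -[X in _ + X]quadE.
have := Dp v^T; have := hess_quad_ge v^T.
have := mulr_gt0 mu_gt0 v0; lra.
Qed.

Lemma hess_psd : psd A.
Proof.
move=> v; rewrite quadE; apply: le_trans (hess_quad_ge v).
by rewrite mulr_ge0 ?dot_ge0 // ltW.
Qed.

End Coercive.

(** * The quadratic objective and one quasi-Newton step *)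

Section Minimizer.
Variables (R : realType) (n : nat) (A : 'M[R]_n) (mu : R).
Implicit Types u v : 'cV[R]_n.
Hypotheses (As : A^T = A) (mu_gt0 : 0 < mu) (A_mu : psd (A - mu%:M)).

Lemma hess_unitmx : A \in unitmx.
Proof.
have psd0 : psd (0 : 'M[R]_n) by move=> v; rewrite /quad mulmx0 mul0mx mxE.
by rewrite -[A]addr0; exact: (coercive_unitmx psd0 mu_gt0 A_mu).
Qed.

Lemma invhess_sym : (invmx A)^T = invmx A.
Proof. by rewrite trmx_inv As. Qed.

(** For [v = A y], add the nonnegative square of [A y - mu y] to [mu] times the form of [A - mu I]
    at [y]. *)
Lemma invhess_le v : mu * quad (invmx A) v <= dot v v.
Proof.
set y := invmx A *m v; have yv : v = A *m y by rewrite mulKVmx ?hess_unitmx.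
rewrite quadE -/y yv dotC.
have h1 := A_mu y; have h2 := dot_ge0 (A *m y - mu *: y).
move: h1 h2; rewrite quadE mulmxBl mul_scalar_mx !dotE (dotC (A *m y) y).
move=> h1 h2; by have := mulr_ge0 (ltW mu_gt0) h1; lra.
Qed.

Lemma invhess_psd : psd (invmx A).
Proof.
move=> v; rewrite quadE -[X in dot X _](mulKVmx hess_unitmx) dotC.
have := hess_psd mu_gt0 A_mu (invmx A *m v); by rewrite quadE.
Qed.

(** Once [b = A x], the gap [fq A b y - fq A b x] is half of [quad A (y - x)]. *)
Lemma fq_min (b x y : 'cV[R]_n) : grad A b x = 0 -> fq A b x <= fq A b y.
Proof.
rewrite /grad => /eqP; rewrite subr_eq0 => /eqP Ax.
have := hess_psd mu_gt0 A_mu (y - x).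
rewrite /fq !quadE mulmxBr -!/(dot b _) -Ax !dotE.
rewrite (dotC (A *m x) y) (dotC (A *m x) x) (dot_adj x y As) (dotC (A *m x) y).
by move=> h; nra.
Qed.

Lemma lamf_le (b x y : 'cV[R]_n) (c : R) : 0 <= c ->
  quad (invmx A) (grad A b x) <= c ^+ 2 * quad (invmx A) (grad A b y) ->
  lamf A b x <= c * lamf A b y.
Proof.
move=> c0 h; apply: le_trans (ler_wsqrtr h) _.
by rewrite sqrtrM ?sqr_ge0 // sqrtr_sqr ger0_norm.
Qed.

Section Step.
Variables (D : 'M[R]_n) (b x x' : 'cV[R]_n).
Hypotheses (Ds : D^T = D) (Dp : psd D).
Hypothesis x'E : x' = x - invmx (A + D) *m grad A b x.
Let u := x' - x.

Lemma step_grad : grad A b x = - ((A + D) *m u).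
Proof.
rewrite /u x'E addrAC subrr add0r mulmxN opprK mulKVmx //.
exact: coercive_unitmx Dp mu_gt0 A_mu.
Qed.

Lemma step_grad_next : grad A b x' = - (D *m u).
Proof.
have -> : grad A b x' = grad A b x + A *m u.
  by rewrite /grad /u mulmxBr [RHS]addrC addrA subrK.
by rewrite step_grad mulmxDl opprD addrAC addNr add0r.
Qed.

(** Expand [(A + D) u] in the form of [invmx A]; the pure [D] term is the next gradient. All three
    terms being nonnegative, both estimates on [lamf] follow from here. *)
Lemma step_lam_sqr : quad (invmx A) (grad A b x) =
  dot u (A *m u) + 2 * dot u (D *m u) + quad (invmx A) (grad A b x').
Proof.
rewrite step_grad step_grad_next; move: u => w.
rewrite !quadE !mulmxN mulmxDl mulmxDr mulKmx ?hess_unitmx //.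
rewrite !dotE (dot_adj (A *m w) (D *m w) invhess_sym) mulKmx ?hess_unitmx //.
by rewrite (dotC (A *m w) w) (dotC (D *m w) w); ring.
Qed.

Lemma lamf_step : lamf A b x' <= lamf A b x.
Proof.
rewrite -[leRHS]mul1r; apply: lamf_le => //; rewrite expr1n mul1r step_lam_sqr.
by rewrite lerDr -!quadE addr_ge0 ?(hess_psd mu_gt0 A_mu) // mulr_ge0.
Qed.

Lemma lamf_step_lmax : 0 <= lmax D -> lamf A b x' <= lmax D / mu * lamf A b x.
Proof.
move=> M0; apply: lamf_le; first by rewrite divr_ge0 // ltW.
have h1 := invhess_le (grad A b x'); have h2 := sqr_le_lmax u Ds Dp.
have h3 := hess_quad_ge A_mu u; have h4 := invhess_psd (grad A b x').
have h5 : dot (grad A b x') (grad A b x') = dot (D *m u) (D *m u).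
  by rewrite step_grad_next !dotE opprK.
have h6 := Dp u; rewrite quadE in h6; have M2 := sqr_ge0 (lmax D).
rewrite expr_div_n mulrAC ler_pdivlMr ?exprn_gt0 //; rewrite h5 in h1.
(* The length of the step links both ends: it bounds the new gradient through [lmax D], and is
   bounded by the old one through [mu]. *)
have h7 : mu * dot u u <= quad (invmx A) (grad A b x).
  by rewrite step_lam_sqr; lra.
apply: le_trans (_ : mu * (lmax D ^+ 2 * dot u u) <= _).
  by rewrite mulrC expr2 -mulrA ler_pM2l //; apply: le_trans h1 h2.
by rewrite mulrCA ler_wpM2l.
Qed.

End Step.
End Minimizer.

(** * The SR1 iteration and its convergence rate *)

Section Iteration.
Variables (R : realType) (n : nat) (A : 'M[R]_n) (b : 'cV[R]_n) (mu : R).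
Variables (x : nat -> 'cV[R]_n) (G : nat -> 'M[R]_n).
Hypotheses (As : A^T = A) (mu_gt0 : 0 < mu) (A_mu : psd (A - mu%:M)).
Hypotheses (G0s : (G 0%N)^T = G 0%N) (D0p : psd (G 0%N - A)).
Hypothesis xS : forall k, x k.+1 = x k - invmx (G k) *m grad A b (x k).
Hypothesis GS : forall k, G k.+1 = SR1 A (G k) (x k.+1 - x k).

Local Notation D k := (G k - A).
Local Notation u k := (x k.+1 - x k).
Local Notation curved k := (forall i, (i < k)%N -> 0 < quad (D i) (u i)).

Lemma hessE k : A + D k = G k.
Proof. by rewrite addrC subrK. Qed.

Lemma D0_sym : (D 0)^T = D 0.
Proof. by rewrite linearB /= G0s As. Qed.

Lemma DS k : curved k.+1 -> D k.+1 = downdate (D k) (u k).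
Proof. by move=> c; rewrite GS SR1_sub // c. Qed.

Lemma D_sym_psd k : curved k -> (D k)^T = D k /\ psd (D k).
Proof.
elim: k => [_|k IHk c]; first by rewrite D0_sym.
have [i /ltnW|Ds Dp] := IHk; first exact: c.
rewrite DS //; split; first exact: downdate_sym.
by apply: downdate_psd => //; exact: c.
Qed.

(** The additive form also yields [k <= n], which later keeps the natural subtraction [n - j] from
    truncating. *)
Lemma D_rank k : curved k -> (\rank (D k) + k <= n)%N.
Proof.
elim: k => [_|k IHk c]; first by rewrite addn0 rank_leq_row.
have ck : curved k by move=> i /ltnW; exact: c.
have [Ds _] := D_sym_psd ck; rewrite DS // addnS -addSn.
by apply: leq_trans (IHk ck); rewrite leq_add2r downdate_rank ?c.
Qed.

Lemma D_spectrum k v : curved k ->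
  lmin (D 0) * dot v (D k *m v) <= dot (D k *m v) (D k *m v) /\
  dot v (D k *m v) <= lmax (D 0) * dot v v.
Proof.
elim: k v => [|k IHk] v c.
  by rewrite quad_le_lmax ?D0_sym // lmin_quad ?D0_sym.
have ck : curved k by move=> i /ltnW; exact: c.
have [Ds Dp] := D_sym_psd ck; have q0 := c k (ltnSn k); rewrite DS //; split.
  by apply: downdate_lower => // w; have [] := IHk w ck.
rewrite -quadE; apply: le_trans (downdate_quad_le v Ds q0) _.
by rewrite quadE; have [] := IHk v ck.
Qed.

Lemma D_lmin_lmax k : curved k.+1 ->
  [/\ 0 < lmin (D 0), lmin (D 0) <= lmin (D k), 0 <= lmax (D k)
    & lmax (D k) <= lmax (D 0)].
Proof.
move=> c; have ck : curved k by move=> i /ltnW; exact: c.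
have [Ds Dp] := D_sym_psd ck; have q0 := c k (ltnSn k); split.
- have [a aD a0] := eigs_neq0 D0_sym (c 0%N isT).
  have [lD l0] := lmin_mem aD a0.
  by rewrite lt_neqAle eq_sym l0 (eigs_ge0 D0_sym D0p lD).
- by apply: (lmin_ge Ds Dp q0) => v; have [] := D_spectrum v ck.
- have [a aD _] := eigs_neq0 Ds q0.
  exact: le_trans (eigs_ge0 Ds Dp aD) (eigs_le_lmax Ds aD).
- by apply: (lmax_le Ds q0) => v; have [] := D_spectrum v ck.
Qed.

Lemma lamf_decr k : curved k -> lamf A b (x k) <= lamf A b (x 0).
Proof.
elim: k => // k IHk c; have ck : curved k by move=> i /ltnW; exact: c.
have [Ds Dp] := D_sym_psd ck; apply: le_trans (IHk ck).
by apply: (@lamf_step _ _ _ _ As mu_gt0 A_mu (D k)) => //; rewrite hessE xS.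
Qed.

Let rate j := 1 - lmin (D j.-1) / \sum_(1 <= i < (n - j + 1).+1) lam (D j.-1) i.

Lemma rateE j : curved j.+1 -> rate j.+1 = 1 - lmin (D j) / \tr (D j).
Proof.
move=> c; have cj : curved j by move=> i /ltnW; exact: c.
have [Ds Dp] := D_sym_psd cj; rewrite /rate sum_lam //.
have jn : (j.+1 <= n)%N by rewrite (leq_trans _ (D_rank c)) // leq_addl.
(* Since [j < n], the bound [n - j.+1 + 1] is [n - j], at least the rank of [D j]; hence the partial
   sum is the full trace. *)
by rewrite addn1 -subSn // subSS leq_subRL ?(ltnW jn) // addnC D_rank.
Qed.

Lemma rate_trace j : curved j.+1 ->
  0 <= rate j.+1 /\ rate j.+1 * \tr (D j) = \tr (D j) - lmin (D j).
Proof.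
move=> c; have cj : curved j by move=> i /ltnW; exact: c.
have [Ds Dp] := D_sym_psd cj; have q0 := c j (ltnSn j).
have t0 := trace_gt0 Ds Dp q0; have [_ _ M0 _] := D_lmin_lmax c.
rewrite rateE // mulrBl mul1r divfK ?gt_eqF //; split=> //.
rewrite subr_ge0 ler_pdivrMr // mul1r.
by have [h|->] := lmax_lmin_trace Ds Dp; lra.
Qed.

Lemma prod_rate_ge0 k : curved k -> 0 <= \prod_(1 <= j < k.+1) rate j.
Proof.
elim: k => [_|k IHk c]; first by rewrite big_geq.
have ck : curved k by move=> i /ltnW; exact: c.
by rewrite big_nat_recr //= mulr_ge0 ?IHk //; have [] := rate_trace c.
Qed.

Lemma trace_le_prod k : curved k ->
  \tr (D k) <= (\prod_(1 <= j < k.+1) rate j) * \tr (D 0).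
Proof.
elim: k => [_|k IHk c]; first by rewrite big_geq // mul1r.
have ck : curved k by move=> i /ltnW; exact: c.
have [Ds Dp] := D_sym_psd ck; have [r0 rE] := rate_trace c.
rewrite DS //; apply: le_trans (downdate_trace Ds Dp (c k (ltnSn k))) _.
by rewrite big_nat_recr //= mulrAC -rE [leRHS]mulrC ler_wpM2l ?IHk.
Qed.

Lemma rate_le j : curved j.+1 ->
  rate j.+1 <= 1 - 1 / ((n - j.+1 + 1)%:R * kappa (D 0)).
Proof.
move=> c; have cj : curved j by move=> i /ltnW; exact: c.
have [Ds Dp] := D_sym_psd cj; have q0 := c j (ltnSn j).
have t0 := trace_gt0 Ds Dp q0; have [m0 mj M0 Mj] := D_lmin_lmax c.
have jn : (j.+1 <= n)%N by rewrite (leq_trans _ (D_rank c)) // leq_addl.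
rewrite rateE // lerD2l lerN2 /kappa.
set N : R := _%:R; have tN : \tr (D j) <= N * lmax (D 0).
  have jN : (\rank (D j) <= n - j.+1 + 1)%N.
    by rewrite addn1 -subSn // subSS leq_subRL ?(ltnW jn) // addnC D_rank.
  rewrite -(sum_lam Ds Dp jN).
  apply: le_trans (_ : \sum_(1 <= i < (n - j.+1 + 1).+1) lmax (D 0) <= _).
    apply: ler_sum => i _; rewrite /lam.
    have [i_lt|i_ge] := ltnP i.-1 (size (eigs (D j))).
      by apply: le_trans Mj; apply: eigs_le_lmax => //; exact: mem_nth.
    (* Beyond the list, [lam] is the default 0. *)
    by rewrite nth_default // (le_trans M0).
  by rewrite sumr_const_nat subn1 /= mulr_natl.
have NM : 0 < N * lmax (D 0) := lt_le_trans t0 tN.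
rewrite mulrA div1r invf_div ler_pdivrMr // mulrAC ler_pdivlMr //.
have l0 := lt_le_trans m0 mj.
(* After clearing denominators, first bound the trace by [tN], then [lmin (D 0)] by [lmin (D j)]. *)
apply: le_trans (_ : lmin (D 0) * (N * lmax (D 0)) <= _).
  by rewrite ler_wpM2l // ltW.
by rewrite ler_wpM2r // ltW.
Qed.

Lemma prod_rate_le k : curved k -> \prod_(1 <= j < k.+1) rate j
  <= \prod_(1 <= j < k.+1) (1 - 1 / ((n - j + 1)%:R * kappa (D 0))).
Proof.
elim: k => [_|k IHk c]; first by rewrite !big_geq.
have ck : curved k by move=> i /ltnW; exact: c.
rewrite [leLHS]big_nat_recr //= [leRHS]big_nat_recr //=.
apply: ler_pM; rewrite ?prod_rate_ge0 ?IHk ?rate_le //.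
by have [] := rate_trace c.
Qed.

(** At [k = 0] the empty product would leave the factor [\tr (D 0) / mu], which may be below 1. *)
Lemma lamf_rate k : (0 < k)%N -> curved k.+1 -> lamf A b (x k) <=
  (\prod_(1 <= j < k.+1) rate j) * (\tr (D 0) / mu) * lamf A b (x 0).
Proof.
case: k => // k _ c; have ck1 : curved k.+1 by move=> i /ltnW; exact: c.
have ck : curved k by move=> i /ltnW; exact: ck1.
have [Ds Dp] := D_sym_psd ck; have [_ _ M0 _] := D_lmin_lmax ck1.
have step : lamf A b (x k.+1) <= lmax (D k) / mu * lamf A b (x k).
  apply: (@lamf_step_lmax _ _ _ _ As mu_gt0 A_mu (D k)) => //.
  by rewrite hessE xS.
have Mt : lmax (D k) <= \tr (D k) - lmin (D k).
  (* If [tr D_k = lambda_min(D_k)], then [tr D_{k+1} <= 0], contradicting the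
     positive curvature at step [k+1]. *)
  have [|e] := lmax_lmin_trace Ds Dp; first by lra.
  have [D's D'p] := D_sym_psd ck1.
  have := trace_gt0 D's D'p (c k.+1 (ltnSn _)).
  have := downdate_trace Ds Dp (ck1 k (ltnSn k)).
  by rewrite -DS // e; lra.
apply: le_trans step _; apply: ler_pM (lamf_decr ck);
  rewrite ?divr_ge0 ?sqrtr_ge0 ?(ltW mu_gt0) //.
rewrite mulrA ler_wpM2r ?invr_ge0 ?(ltW mu_gt0) //; apply: le_trans Mt _.
(* The bound on [lmax (D k)] is [rate k.+1 * \tr (D k)]: this is the last factor, and
   [trace_le_prod] supplies the earlier ones. *)
have [r0 <-] := rate_trace ck1; rewrite big_nat_recr //= mulrAC [leRHS]mulrC.
by rewrite ler_wpM2l ?trace_le_prod.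
Qed.

Lemma lamf_rate_kappa k : curved k.+1 ->
  (\prod_(1 <= j < k.+1) rate j) * (\tr (D 0) / mu) * lamf A b (x 0)
    <= (\prod_(1 <= j < k.+1) (1 - 1 / ((n - j + 1)%:R * kappa (D 0))))
       * (\tr (D 0) / mu) * lamf A b (x 0).
Proof.
move=> c; have ck : curved k by move=> i /ltnW; exact: c.
have t0 := trace_gt0 D0_sym D0p (c 0%N isT).
by rewrite !ler_wpM2r ?sqrtr_ge0 ?divr_ge0 ?(ltW t0) ?(ltW mu_gt0) //
  prod_rate_le.
Qed.

(** For semidefinite [D k], zero curvature forces [D k] to annihilate the step, and the next
    gradient is minus that product. *)
Lemma grad_final k : curved k -> quad (D k) (u k) = 0 -> grad A b (x k.+1) = 0.
Proof.
move=> ck q0; have [Ds Dp] := D_sym_psd ck.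
rewrite (@step_grad_next _ _ _ _ mu_gt0 A_mu (D k) b (x k)) //.
  by rewrite psd_ker ?oppr0.
by rewrite hessE xS.
Qed.

End Iteration.
Unset Implicit Arguments.
Set Strict Implicit.

Theorem theorem1 (R : realType) (n : nat) (A G0 : 'M[R]_n) (b x0 : 'cV[R]_n)
  (mu L : R) (x : nat -> 'cV[R]_n) (G : nat -> 'M[R]_n) :
  A^T = A -> 0 < mu -> mu <= L ->
  psd (A - mu%:M) -> psd (L%:M - A) ->
  G0^T = G0 -> psd (G0 - A) ->
  x 0%N = x0 -> G 0%N = G0 ->
  (forall k, x k.+1 = x k - invmx (G k) *m grad A b (x k)) ->
  (forall k, G k.+1 = SR1 A (G k) (x k.+1 - x k)) ->
  (forall k : nat, (0 < k)%N ->
     (forall i : nat, (i <= k)%N -> 0 < quad (G i - A) (x i.+1 - x i)) ->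
     lamf A b (x k)
       <= (\prod_(1 <= j < k.+1)
             (1 - lmin (G j.-1 - A) /
                  \sum_(1 <= i < (n - j + 1).+1) lam (G j.-1 - A) i))
          * (\tr (G0 - A) / mu) * lamf A b x0
     /\
     (\prod_(1 <= j < k.+1)
             (1 - lmin (G j.-1 - A) /
                  \sum_(1 <= i < (n - j + 1).+1) lam (G j.-1 - A) i))
          * (\tr (G0 - A) / mu) * lamf A b x0
       <= (\prod_(1 <= j < k.+1)
             (1 - 1 / ((n - j + 1)%:R * kappa (G0 - A))))
          * (\tr (G0 - A) / mu) * lamf A b x0)
  /\
  (forall k : nat, (1 < k)%N ->
     quad (G k - A) (x k.+1 - x k) = 0 ->
     (forall i : nat, (i < k)%N -> 0 < quad (G i - A) (x i.+1 - x i)) ->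
     forall y : 'cV[R]_n, fq A b (x k.+1) <= fq A b y).
Proof.
move=> As mu_gt0 _ A_mu _ G0s D0p <- GE0 xS GS; subst G0.
split=> k k_gt0 c.
  split; first exact: (lamf_rate As mu_gt0 A_mu G0s D0p xS GS).
  exact: (lamf_rate_kappa b As mu_gt0 G0s D0p GS).
move=> ck y; apply: (fq_min As mu_gt0 A_mu).
exact: (grad_final As mu_gt0 A_mu G0s D0p xS GS ck).
Qed.
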